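(* Let $H=(V,E,w)$ be a hypergraph as in the context, let $\mathcal{L}$ be its normalized Laplacian and $\mathcal{D}$ its normalized discrepancy ratio, both defined in the context. Then for every nonzero $x\in\mathbb{R}^V$ the Rayleigh quotient $\mathcal{R}(x):=\frac{\langle x,\mathcal{L}x\rangle}{\langle x,x\rangle}$ equals $\mathcal{D}(x)$. Moreover, the quantity $\gamma_2:=\min\{\mathcal{D}(x): 0\neq x\in\mathbb{R}^V,\ x\perp W^{1/2}\mathbf{1}\}$ is an eigenvalue of $\mathcal{L}$, and every minimizer $x_2$ of this minimization is a corresponding eigenvector, i.e. $\mathcal{L}x_2=\gamma_2 x_2$.
   Context: $H=(V,E,w)$: $V$ finite, $n=|V|\ge 2$, every hyperedge $e\in E$ is a nonempty subset of $V$, edge weights $w_e\ge 0$. Vertex weights $w_v=\sum_{e\in E: v\in e}w_e$, assumed $>0$ for all $v$; $w(X)=\sum_{v\in X}w_v$. $W$ is the diagonal $V\times V$ matrix with $W_{vv}=w_v$, $\mathbf{1}$ the all-ones vector, $\langle\cdot,\cdot\rangle$ the standard inner product on $\mathbb{R}^V$. Normalized discrepancy ratio: for $x\neq 0$, $\mathcal{D}(x)=\frac{\sum_{e\in E}w_e\max_{u,v\in e}\big(\frac{x_u}{\sqrt{w_u}}-\frac{x_v}{\sqrt{w_v}}\big)^2}{\sum_{u\in V}x_u^2}$. Laplacian. For $f\in\mathbb{R}^V$ and $e\in E$ let $S_e(f)=\{u\in e: f_u=\max_{v\in e}f_v\}$, $I_e(f)=\{u\in e: f_u=\min_{v\in e}f_v\}$,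 $c_e=w_e(\max_{v\in e}f_v-\min_{v\in e}f_v)$; for $F\subseteq E$, $c(F)=\sum_{e\in F}c_e$. Define $r=r(f)\in\mathbb{R}^V$ as follows. Partition $V$ into classes of vertices having equal $f$-value. For each class $U$, start with the edge set $E_U=\{e\in E:(I_e(f)\cup S_e(f))\cap U\neq\emptyset\}$; for nonempty $X\subseteq U$ set $I_X=\{e\in E_U: I_e(f)\subseteq X\}$, $S_X=\{e\in E_U: S_e(f)\cap X\neq\emptyset\}$ and $\delta(X)=\frac{c(I_X)-c(S_X)}{w(X)}$; choose a nonempty $P\subseteq U$ maximizing $\delta$, set $r_u=\delta(P)$ for all $u\in P$, and then repeat the same step with $U\setminus P$ in place of $U$ and $E_U\setminus(I_P\cup S_P)$ in place of $E_U$ (recomputing $I_X,S_X,\delta$ relative to the new edge set) until every vertex of $U$ has received a value. (The resulting $r$ does not depend on which maximizers are chosen.) The operator on the weighted space is $\mathcal{L}_w f=-r(f)$, and the normalized Laplacian is $\mathcal{L}x=W^{1/2}\mathcal{L}_w(W^{-1/2}x)$ for $x\in\mathbb{R}^V$ (a generally nonlinear map).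
   Formalization: In the repeated steps, I_X is taken as the remaining edges e whose I_e(f) meets the remaining set U and has I_e(f)∩U ⊆ X, instead of I_e(f) ⊆ X; with the literal rule, an edge whose I_e(f) is split between steps is never counted and R(x)=D(x) fails. *)

(* Defs.v *)
From mathcomp Require Import classical_sets reals.
From mathcomp Require Import all_boot all_order all_algebra.

Set Implicit Arguments.
Unset Strict Implicit.
Unset Printing Implicit Defensive.

Import Order.TTheory GRing.Theory Num.Theory.

Local Open Scope ring_scope.

(* A hypergraph on the finite vertex type V is given by its set of hyperedges
   E : {set {set V}} and the edge weights w : {set V} -> R, of which only the
   values on E are ever used.
   R^V is {ffun V -> R^o}; R^o (convertible to R) provides the scalar action
   [a *: x]. *)

Section Extrema.
Context {R : realType} {T : finType}.
Implicit Types (A : {set T}) (g : T -> R).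

(* Maximum and minimum of g over A, for nonempty A. The seed of the iterated
   max/min is a value of g on A; the value 0 on A = set0 is a dummy. *)
Definition max_over A g : R :=
  if [pick a in A] is Some a0 then \big[Num.max/g a0]_(a in A) g a else 0.

Definition min_over A g : R :=
  if [pick a in A] is Some a0 then \big[Num.min/g a0]_(a in A) g a else 0.

End Extrema.

Definition is_min {R : realType} (A : set R) (m : R) : Prop :=
  A m /\ lbound A m.

Section Hypergraph.
Context {R : realType} {V : finType}.
Variables (E : {set {set V}}) (w : {set V} -> R).
Implicit Types (e U X : {set V}) (F : {set {set V}}) (f x y : {ffun V -> R^o}).

Definition inner x y : R := \sum_v x v * y v.

Definition vweight (v : V) : R := \sum_(e in E | v \in e) w e.

Definition weight X : R := \sum_(v in X) vweight v.

(* x |-> W^{1/2} x and x |-> W^{-1/2} x *)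
Definition Wsqrt x : {ffun V -> R^o} :=
  [ffun v => Num.sqrt (vweight v) * x v].

Definition Winvsqrt x : {ffun V -> R^o} :=
  [ffun v => (Num.sqrt (vweight v))^-1 * x v].

Definition discrepancy_ratio x : R :=
  (\sum_(e in E) w e *
     max_over (setX e e)
       (fun p => (x p.1 / Num.sqrt (vweight p.1)
                  - x p.2 / Num.sqrt (vweight p.2)) ^+ 2))
  / \sum_u x u ^+ 2.

Section Rates.
Variable f : {ffun V -> R^o}.

(* S_e(f) and I_e(f) *)
Definition Smax e : {set V} := [set u in e | f u == max_over e f].

Definition Imin e : {set V} := [set u in e | f u == min_over e f].

Definition cost e : R := w e * (max_over e f - min_over e f).

Definition total_cost F : R := \sum_(e in F) cost e.

(* In the procedure below, U is the set of vertices of a class that have not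
   received a value yet, F is the current edge set, and X is a nonempty subset
   of U.

   Membership of e in I_X is relative to the remaining vertices U: the part of
   I_e(f) that is still in U must be nonempty and contained in X. When U is the
   whole class this says I_e(f) \subset X (lemma I_edges_class). In later steps
   the vertices of I_e(f) that already have a value must be ignored: otherwise
   an edge whose I_e(f) is split between two steps would never be counted, r
   would depend on the choice of the maximizers, and <f, r>_w would no longer
   be - \sum_e w_e (max_e f - min_e f)^2. *)
Definition I_edges U F X : {set {set V}} :=
  [set e in F | (Imin e :&: U != set0) && (Imin e :&: U \subset X)].

Definition S_edges F X : {set {set V}} := [set e in F | Smax e :&: X != set0].

Definition delta U F X : R :=
  (total_cost (I_edges U F X) - total_cost (S_edges F X)) / weight X.

(* A nonempty subset of U maximizing delta, for U nonempty; the rates do not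
   depend on how ties are broken. *)
Definition densest U F : {set V} :=
  [arg max_(X > U | (X != set0) && (X \subset U)) delta U F X]%O.

(* The step for (U, F) followed by the steps for the vertices left over; k
   bounds the number of steps. Each step removes at least one vertex, so that
   k = #|U| is enough for every vertex of U to receive a value. *)
Fixpoint assign_rates (k : nat) U F (v : V) : R :=
  if k is k'.+1 then
    let P := densest U F in
    if v \in P then delta U F P
    else assign_rates k' (U :\: P) (F :\: (I_edges U F P :|: S_edges F P)) v
  else 0.

Definition fclass (v : V) : {set V} := [set u | f u == f v].

Definition class_edges U : {set {set V}} :=
  [set e in E | (Imin e :|: Smax e) :&: U != set0].

Definition rate : {ffun V -> R^o} :=
  [ffun v => assign_rates #|fclass v| (fclass v) (class_edges (fclass v)) v].

Lemma I_edges_class (v : V) X F :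
  X \subset fclass v -> {in F, forall e, Imin e != set0} ->
  I_edges (fclass v) F X = [set e in F | Imin e \subset X].
Proof.
move=> sXU Fn0; apply/setP=> e; rewrite !inE.
case eF: (e \in F) => //=.
have IU u : u \in Imin e -> u \in fclass v -> Imin e \subset fclass v.
  rewrite !inE => /andP[_ /eqP fu] /eqP fv.
  by apply/subsetP=> t; rewrite !inE => /andP[_ /eqP->]; rewrite -fu fv.
apply/andP/idP => [[/set0Pn[u]]|sIX].
  by rewrite inE => /andP[uI uU]; rewrite (setIidPl (IU u uI uU)).
by rewrite (setIidPl (subset_trans sIX sXU)) Fn0.
Qed.

End Rates.

(* The Laplacian of the weighted space. *)
Definition Lw f : {ffun V -> R^o} := - rate f.

Definition Laplacian x : {ffun V -> R^o} := Wsqrt (Lw (Winvsqrt x)).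

Definition Rayleigh x : R := inner x (Laplacian x) / inner x x.

(* Nonzero vectors orthogonal to W^{1/2} 1. *)
Definition admissible x : Prop :=
  x != 0 /\ inner x (Wsqrt [ffun=> 1]) = 0.

End Hypergraph.

Definition is_eigenvector {R : realType} {V : finType}
    (L : {ffun V -> R^o} -> {ffun V -> R^o}) (a : R) (x : {ffun V -> R^o}) :=
  x != 0 /\ L x = a *: x.

Definition is_eigenvalue {R : realType} {V : finType}
    (L : {ffun V -> R^o} -> {ffun V -> R^o}) (a : R) :=
  exists x, is_eigenvector L a x.

(* Main.v *)
Require Import Defs.
From mathcomp Require Import boolp classical_sets reals.
From mathcomp Require Import topology normedtype derive.
From mathcomp Require Import all_boot all_order all_algebra.
From mathcomp Require Import ring lra.

(** Write f = W^{-1/2} x, r = r(f), <.,.>_w for the weighted inner product and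
    Q(f) = sum_e w_e (max_e f - min_e f)^2, so that D(x) = Q(f) / <f, f>_w.
    In the procedure that defines r, a set P with rate delta(P) contributes
    w(P) delta(P) = c(I_P) - c(S_P), so summing by parts over the steps of a
    class turns sums over vertices into sums over edges: <f, r>_w = - Q(f), hence
    R = D, and <1, r>_w = 0. Since P maximizes delta, the rates decrease along the
    procedure; therefore the maximum of r on S_e is the rate of the first step that
    meets S_e and the minimum of r on I_e is the rate of the last step that meets
    I_e, and the same summation gives
      <r, r>_w = - sum_e c_e (max_{S_e} r - min_{I_e} r),
    which is minus half the directional derivative of Q at f along r.
    If x minimizes D, then Q(f + t r) >= gamma |f + t r|_w^2 for all t, and the
    first order in t yields |r|_w^2 <= gamma^2 |f|_w^2. Together with
    <f, r>_w = - gamma |f|_w^2 this gives |r + gamma f|_w^2 <= 0, that is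
    r = - gamma f. A minimizer exists by compactness of the unit sphere. *)

Set Implicit Arguments.
Unset Strict Implicit.
Unset Printing Implicit Defensive.

Import Order.TTheory GRing.Theory Num.Theory.
Import numFieldTopology.Exports numFieldNormedType.Exports.
Local Open Scope ring_scope.

(** * Maxima and minima over a set *)

Section ExtremaTheory.
Context {R : realType} {T : finType}.
Implicit Types (A : {set T}) (g h : T -> R).

Lemma max_over_mem A g : A != set0 -> exists2 a, a \in A & max_over A g = g a.
Proof.
move=> /set0Pn[b bA]; rewrite /max_over; case: pickP => [a aA|/(_ b)]; last first.
  by rewrite bA.
apply: (big_ind (fun y => exists2 c, c \in A & y = g c)); first by exists a.
  move=> y z [c cA ->] [d dA ->].
  by case: (leP (g c) (g d)) => _; [exists d | exists c].
by move=> c cA; exists c.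
Qed.

Lemma min_over_mem A g : A != set0 -> exists2 a, a \in A & min_over A g = g a.
Proof.
move=> /set0Pn[b bA]; rewrite /min_over; case: pickP => [a aA|/(_ b)]; last first.
  by rewrite bA.
apply: (big_ind (fun y => exists2 c, c \in A & y = g c)); first by exists a.
  move=> y z [c cA ->] [d dA ->].
  by case: (leP (g c) (g d)) => _; [exists c | exists d].
by move=> c cA; exists c.
Qed.

Lemma le_max_over A g a : a \in A -> g a <= max_over A g.
Proof.
move=> aA; rewrite /max_over; case: pickP => [b bA|/(_ a)]; last by rewrite aA.
by apply: (@le_bigmax_cond _ _ _ _ _ (mem A)).
Qed.

Lemma ge_min_over A g a : a \in A -> min_over A g <= g a.
Proof.
move=> aA; rewrite /min_over; case: pickP => [b bA|/(_ a)]; last by rewrite aA.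
by apply: (@bigmin_le_cond _ _ _ _ _ (mem A)).
Qed.

Lemma max_over_eq A g a :
  a \in A -> {in A, forall b, g b <= g a} -> max_over A g = g a.
Proof.
move=> aA ga; apply/le_anti; rewrite le_max_over // andbT.
have [|b bA ->] := @max_over_mem A g; last exact: ga.
by apply/set0Pn; exists a.
Qed.

Lemma min_over_eq A g a :
  a \in A -> {in A, forall b, g a <= g b} -> min_over A g = g a.
Proof.
move=> aA ga; apply/le_anti; rewrite ge_min_over //=.
have [|b bA ->] := @min_over_mem A g; last exact: ga.
by apply/set0Pn; exists a.
Qed.

Lemma max_over0 g : max_over set0 g = 0.
Proof. by rewrite /max_over; case: pickP => // a; rewrite inE. Qed.

Lemma min_over0 g : min_over set0 g = 0.
Proof. by rewrite /min_over; case: pickP => // a; rewrite inE. Qed.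

(** The boolean factor accounts for the dummy value 0 on the empty set. With [c = 1] this evaluates
    the edge terms of the identities that are linear in the rate. *)
Lemma max_over_cst A (c : R) : max_over A (fun=> c) = c *+ (A != set0).
Proof.
have [->|/set0Pn[a aA]] := eqVneq A set0; first by rewrite max_over0.
by rewrite (@max_over_eq _ _ a).
Qed.

Lemma min_over_cst A (c : R) : min_over A (fun=> c) = c *+ (A != set0).
Proof.
have [->|/set0Pn[a aA]] := eqVneq A set0; first by rewrite min_over0.
by rewrite (@min_over_eq _ _ a).
Qed.

Lemma eq_max_over A g h : {in A, g =1 h} -> max_over A g = max_over A h.
Proof.
move=> gh; have [->|A0] := eqVneq A set0; first by rewrite !max_over0.
have [a aA e] := max_over_mem g A0; rewrite e gh //; apply/esym.
by apply: max_over_eq => // b bA; rewrite -!gh // -e le_max_over.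
Qed.

Lemma eq_min_over A g h : {in A, g =1 h} -> min_over A g = min_over A h.
Proof.
move=> gh; have [->|A0] := eqVneq A set0; first by rewrite !min_over0.
have [a aA e] := min_over_mem g A0; rewrite e gh //; apply/esym.
by apply: min_over_eq => // b bA; rewrite -!gh // -e ge_min_over.
Qed.

Lemma max_overZ A g (k : R) :
  0 <= k -> max_over A (fun a => k * g a) = k * max_over A g.
Proof.
move=> k0; have [->|A0] := eqVneq A set0; first by rewrite !max_over0 mulr0.
have [a aA e] := max_over_mem g A0; rewrite e.
by apply: max_over_eq => // b bA; rewrite ler_wpM2l // -e le_max_over.
Qed.

Lemma le_min_max_over A g : min_over A g <= max_over A g.
Proof.
have [->|A0] := eqVneq A set0; first by rewrite max_over0 min_over0.
by have [a aA ->] := min_over_mem g A0; apply: le_max_over.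
Qed.

End ExtremaTheory.

(** The pair formed by a maximizer and a minimizer attains the bound, since every other difference
    lies between [min - max] and [max - min]. *)
Lemma max_over_sqr_diff (R : realType) (T : finType) (A : {set T}) (g : T -> R) :
  max_over (setX A A) (fun p => (g p.1 - g p.2) ^+ 2)
  = (max_over A g - min_over A g) ^+ 2.
Proof.
have [->|A0] := eqVneq A set0.
  by rewrite (@cards0_eq _ (setX _ _)) ?cardsX ?cards0 //
     !max_over0 min_over0 subrr expr0n.
have [a aA ea] := max_over_mem g A0.
have [b bA eb] := min_over_mem g A0.
rewrite ea eb (@max_over_eq _ _ _ _ (a, b)) ?inE ?aA //= => -[c d].
rewrite inE /= => /andP[cA dA]; rewrite -ea -eb.
have := le_max_over g cA; have := le_max_over g dA.
have := ge_min_over g cA; have := ge_min_over g dA.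
by nra.
Qed.

(** Replaces the seed, a value of [g], by the constant 0, the form in which the continuity of finite
    maxima applies. *)
Lemma max_over_bigmax (R : realType) (T : finType) (A : {set T}) (g : T -> R) :
  {in A, forall a, 0 <= g a} -> max_over A g = \big[Num.max/0]_(a in A) g a.
Proof.
move=> g0; have [->|A0] := eqVneq A set0; first by rewrite max_over0 big_set0.
have [a aA e] := max_over_mem g A0; apply/le_anti/andP; split.
  by rewrite e (@le_bigmax_cond _ _ _ _ _ (mem A)).
by apply: bigmax_le => [|b bA]; [rewrite e g0 | apply: le_max_over].
Qed.

(** * Summation by parts along the rate procedure *)

Section RatesTheory.
Context {R : realType} {V : finType}.
Variables (E : {set {set V}}) (w : {set V} -> R).
Hypothesis vweight_gt0 : forall v, 0 < vweight E w v.
Hypothesis E_neq0 : forall e, e \in E -> e != set0.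
Hypothesis w_ge0 : forall e, e \in E -> 0 <= w e.
Variable f : {ffun V -> R^o}.
Implicit Types (e U X P : {set V}) (F : {set {set V}}).

Local Notation Imin := (Imin f).
Local Notation Smax := (Smax f).
Local Notation cost := (cost w f).
Local Notation I_edges := (I_edges f).
Local Notation S_edges := (S_edges f).
Local Notation delta := (delta E w f).
Local Notation densest := (densest E w f).
Local Notation assign_rates := (assign_rates E w f).
Local Notation rest U F P := (F :\: (I_edges U F P :|: S_edges F P)).

Lemma weight_gt0 X : X != set0 -> 0 < weight E w X.
Proof.
case/set0Pn=> v vX; rewrite /weight (bigD1 v) //= ltr_pwDl //.
by apply: sumr_ge0 => u _; apply: ltW.
Qed.

Lemma cost_ge0 e : e \in E -> 0 <= cost e.
Proof. by move=> eE; rewrite mulr_ge0 ?w_ge0 // subr_ge0 le_min_max_over. Qed.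

Lemma densestP U F : U != set0 ->
  [/\ densest U F != set0, densest U F \subset U &
      forall X, X != set0 -> X \subset U ->
        delta U F X <= delta U F (densest U F)].
Proof.
move=> U0; rewrite /densest; case: arg_maxP; first by rewrite U0 subxx.
by move=> P /andP[P0 PU] Pmax; split=> // X X0 XU; apply: Pmax; rewrite X0.
Qed.

(* Satisfied by parts U of a class: an edge with both its minimum and its
   maximum in U is constant. *)
Definition separated U F := {in F, forall e,
  Imin e :&: U != set0 -> Smax e :&: U != set0 -> cost e = 0}.

Lemma separatedS U F U' F' :
  U' \subset U -> F' \subset F -> separated U F -> separated U' F'.
Proof.
move=> sU sF sep e eF' IU SU; apply: sep; first exact: (subsetP sF).
  by apply: contraNneq IU => IU0; rewrite -subset0 -IU0 setIS.
by apply: contraNneq SU => SU0; rewrite -subset0 -SU0 setIS.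
Qed.

(** The case split behind every edge-by-edge argument below: an edge that matters meets [U] through
    its minima only or through its maxima only. *)
Lemma separated_cases U F e : separated U F -> e \in F -> cost e != 0 ->
  Imin e :&: U = set0 \/ Smax e :&: U = set0.
Proof.
move=> sep eF cen0.
have [|IU0] := eqVneq (Imin e :&: U) set0; first by left.
have [|SU0] := eqVneq (Smax e :&: U) set0; first by right.
by rewrite sep // eqxx in cen0.
Qed.

Lemma total_cost_sub F F' : F' \subset F ->
  total_cost w f F' = \sum_(e in F) cost e *+ (e \in F').
Proof.
move=> sF; rewrite /total_cost [RHS](bigID (mem F')) /= [X in _ + X]big1 ?addr0.
  apply: eq_big => [e|e eF']; last by rewrite eF'.
  by apply/idP/andP => [eF'|[]//]; rewrite (subsetP sF).
by move=> e /andP[_ /negPf->].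
Qed.

(** Clears the denominator and spreads the two costs over all of [F], so that different steps can be
    compared one edge at a time. *)
Lemma delta_mul_weight U F P : P != set0 ->
  weight E w P * delta U F P =
  \sum_(e in F) (cost e *+ (e \in I_edges U F P) - cost e *+ (e \in S_edges F P)).
Proof.
move=> P0; rewrite /delta mulrC divfK ?gt_eqF ?weight_gt0 //.
rewrite !(@total_cost_sub F) ?sumrB //.
  by apply/subsetP=> e; rewrite inE => /andP[].
by apply/subsetP=> e; rewrite inE => /andP[].
Qed.

(* Mediant inequality: if the second step had a larger rate than the first, the
   union of the two steps would beat the first one. *)
Lemma delta_rest U F P P' :
  F \subset E -> separated U F ->
  P != set0 -> P \subset U -> P' != set0 -> P' \subset U :\: P ->
  delta U F (P :|: P') <= delta U F P ->
  delta (U :\: P) (rest U F P) P' <= delta U F P.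
Proof.
move=> FE sep P0 PU P'0 P'U dmax.
have PP'0 : P :|: P' != set0 by rewrite setU_eq0 negb_and P0.
have wPP' : weight E w (P :|: P') = weight E w P + weight E w P'.
  rewrite /weight (big_setID P) /= setUK; congr (_ + _).
  by rewrite setDUl setDv set0U (setDidPl _) // disjoints_subset;
     apply: subset_trans P'U _; rewrite setDE subsetIr.
have := weight_gt0 P0; have wP'_gt0 := weight_gt0 P'0.
(* Weights add up over disjoint sets, so this inequality and [dmax] leave
   [w(P') delta' <= w(P') delta(P)], where [delta'] is the rate of the second step. *)
suff le : weight E w P * delta U F P +
    weight E w P' * delta (U :\: P) (rest U F P) P' <=
    weight E w (P :|: P') * delta U F (P :|: P').
  move: le; rewrite wPP'; set a := delta _ _ _ in dmax *.
  by move: dmax wP'_gt0; nra.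
rewrite !delta_mul_weight //.
rewrite [X in _ + X <= _](_ : _ = \sum_(e in F) (
   cost e *+ (e \in I_edges (U :\: P) (rest U F P) P') -
   cost e *+ (e \in S_edges (rest U F P) P'))); last first.
  rewrite [RHS](bigID (mem (rest U F P))) /= [X in _ = _ + X]big1 ?addr0.
    by apply: eq_bigl => e; rewrite !inE; case: (e \in F); rewrite ?andbF ?andbT.
  move=> e /andP[eF]; rewrite !inE eF /= => /negPf->.
  by rewrite subrr.
rewrite -big_split /=; apply: ler_sum => e eF.
have ce0 := cost_ge0 (subsetP FE e eF).
have [->|cen0] := eqVneq (cost e) 0; first by rewrite !mul0rn subrr addr0.
have P_U (A : {set V}) : A \subset U -> forall B, B :&: U = set0 -> B :&: A = set0.
  by move=> AU B BU0; apply/eqP; rewrite -subset0 -BU0 setIS.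
have P'_U : P' \subset U by apply: subset_trans P'U (subsetDl _ _).
(* If only maxima lie in [U], the edge is charged to [P :|: P'] exactly when it is charged to [P]
   or, not having been removed, to [P']. If only minima do, being counted for [P], or later for
   [P'], forces being counted for the union. *)
case: (separated_cases sep eF cen0) => [IU0|SU0]; rewrite !inE eF /= !andbT.
  rewrite IU0 (P_U _ (subsetDl _ _) _ IU0) eqxx /= setIUr setU_eq0 negb_and.
  by case: (Smax e :&: P != set0); case: (_ != set0) => /=; rewrite ?mulr0n ?mulr1n; lra.
have SP0 : Smax e :&: P = set0 by apply: P_U SU0.
rewrite SP0 (P_U _ P'_U _ SU0) setIUr SP0 (P_U _ P'_U _ SU0) setU0 eqxx /=.
rewrite orbF andbF !subr0 setIDA.
have [/andP[I0 IP]|] := boolP ((Imin e :&: U != set0) && _).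
  by rewrite I0 (subset_trans IP) ?subsetUl // addr0.
rewrite mulr0n add0r /= subDset => _.
have [/andP[I0 ->]|_] := boolP (_ && (_ \subset P :|: P')).
  rewrite (_ : _ != set0) //.
  by apply: contraNneq I0 => I0; rewrite I0 set0D.
by rewrite mulr0n mulrn_wge0.
Qed.

(** The first step has the largest rate: by induction a later rate is at most that of the next step,
    and [delta_rest] compares the next step with the current one, its premise being the maximality
    of [densest]. *)
Lemma assign_rates_le k U F v :
  F \subset E -> separated U F -> v \in U -> (#|U| <= k)%N ->
  assign_rates k U F v <= delta U F (densest U F).
Proof.
elim: k U F => [|k IHk] U F FE sep vU.
  by rewrite leqn0 cards_eq0 => /eqP U0; rewrite U0 inE in vU.
move=> Uk /=; case: ifPn => // vP.
have U0 : U != set0 by apply/set0Pn; exists v.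
have [P0 PU Pmax] := densestP F U0.
have vU' : v \in U :\: densest U F by rewrite inE vP.
have U'0 : U :\: densest U F != set0 by apply/set0Pn; exists v.
have rE : rest U F (densest U F) \subset E by apply: subset_trans (subsetDl _ _) FE.
have sep' : separated (U :\: densest U F) (rest U F (densest U F)).
  by apply: separatedS sep; rewrite subsetDl.
have [P'0 P'U _] := densestP (rest U F (densest U F)) U'0.
apply: le_trans (IHk _ _ rE sep' vU' _) _.
  rewrite -ltnS; apply: leq_trans Uk; rewrite -(cardsID (densest U F) U).
  by rewrite (setIidPr PU) -[X in (X < _)%N]add0n ltn_add2r card_gt0.
apply: delta_rest => //; apply: Pmax.
  by rewrite setU_eq0 negb_and P0.
by rewrite subUset PU (subset_trans P'U) // subsetDl.
Qed.

(** A step [P] contributes [(c(I_P) - c(S_P)) G(delta(P))]. An edge is charged in [S] at the first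
    step meeting its maxima and in [I] at the last step meeting its minima; as rates decrease and
    [G] is monotone, these steps carry the extreme values of [G \o r]. The value 0 on empty sets is
    the right one for edges that do not meet [U]. *)
Lemma sum_assign_rates (G : R -> R) k U F :
  {homo G : a b / a <= b} ->
  F \subset E -> separated U F -> (#|U| <= k)%N ->
  let r := assign_rates k U F in
  \sum_(v in U) vweight E w v * r v * G (r v) =
  \sum_(e in F) cost e *
    (min_over (Imin e :&: U) (G \o r) - max_over (Smax e :&: U) (G \o r)).
Proof.
move=> G_homo; elim: k U F => [|k IHk] U F FE sep.
  rewrite leqn0 cards_eq0 => /eqP-> r; rewrite big_set0 big1 // => e _.
  by rewrite !setI0 max_over0 min_over0 subrr mulr0.
have [->|U0] := eqVneq U set0.
  move=> _ r; rewrite big_set0 big1 // => e _.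
  by rewrite !setI0 max_over0 min_over0 subrr mulr0.
move=> Uk; have [P0 PU Pmax] := densestP F U0.
pose P := densest U F; pose U' := U :\: P; pose F' := rest U F P.
have U'k : (#|U'| <= k)%N.
  rewrite -ltnS; apply: leq_trans Uk; rewrite -(cardsID P U).
  by rewrite (setIidPr PU) -[X in (X < _)%N]add0n ltn_add2r card_gt0.
have F'E : F' \subset E by apply: subset_trans (subsetDl _ _) FE.
have sep' : separated U' F' by apply: separatedS sep; rewrite subsetDl.
have r_le v : v \in U -> assign_rates k.+1 U F v <= delta U F P.
  by move=> vU; apply: assign_rates_le.
set r' := assign_rates k U' F'.
have rP v : v \in P -> assign_rates k.+1 U F v = delta U F P.
  by move=> vP /=; rewrite vP.
have rU' v : v \in U' -> assign_rates k.+1 U F v = r' v.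
  by rewrite inE => /andP[/negPf vP _] /=; rewrite vP.
(* From here on only three facts matter: [r] is at most [delta U F P] on [U], equal to it on [P],
   and equal to [r'] on [U']. *)
move: (assign_rates k.+1 U F) => r in r_le rP rU' *.
rewrite /= (big_setID P) /= (setIidPr PU).
rewrite (eq_bigr (fun v => vweight E w v * (delta U F P * G (delta U F P))));
  last by move=> v vP; rewrite rP // mulrA.
rewrite -mulr_suml [X in _ + X](eq_bigr (fun v => vweight E w v * r' v * G (r' v)));
  last by move=> v vU'; rewrite rU'.
rewrite (IHk U' F') // mulrA -/(weight E w P) delta_mul_weight // mulr_suml.
rewrite [X in _ + X = _](_ : _ = \sum_(e in F) (cost e *
    (min_over (Imin e :&: U') (G \o r') - max_over (Smax e :&: U') (G \o r')))
     *+ (e \in F')); last first.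
  rewrite [RHS](bigID (mem F')) /= [X in _ = _ + X]big1 ?addr0.
    apply: eq_big => [e|e eF']; last by rewrite eF'.
    by rewrite /F' inE; case: (e \in F); rewrite ?andbF ?andbT.
  by move=> e /andP[_ /negPf->].
rewrite -big_split /=; apply: eq_bigr => e eF.
have [c0|cen0] := eqVneq (cost e) 0.
  by rewrite c0 !mul0rn !mul0r mul0rn subrr !mul0r addr0.
case: (separated_cases sep eF cen0) => [IU0|SU0].
  have IU'0 : Imin e :&: U' = set0 by rewrite setIDA IU0 set0D.
  rewrite IU0 IU'0 !min_over0 !sub0r !inE eF IU0 eqxx /= andbT.
  (* Either the edge passes untouched to the remaining vertices, or it is charged now and a vertex
     of [P] realizes the maximum by [r_le]. *)
  have [SP0|/set0Pn[u]] := eqVneq (Smax e :&: P) set0.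
    rewrite /= subrr mul0r add0r mulr1n.
    have -> : Smax e :&: U = Smax e :&: U' by rewrite setIDA setDE setIAC -setDE;
      rewrite (_ : Smax e :\: P = Smax e) // (setDidPl _) // -setI_eq0 SP0.
    congr (_ * - _); apply: eq_max_over => u; rewrite inE => /andP[_ uU'] /=.
    by rewrite rU'.
  rewrite inE => /andP[uS uP]; rewrite /= mulr0n addr0 mulr1n add0r.
  rewrite (@max_over_eq _ _ _ _ u) ?in_setI ?uS ?(subsetP PU) //= ?rP //.
    by rewrite mulrN mulNr.
  by move=> v; rewrite inE => /andP[_ vU]; apply/G_homo/r_le.
have SU'0 : Smax e :&: U' = set0 by rewrite setIDA SU0 set0D.
have SP0 : Smax e :&: P = set0.
  by apply/eqP; rewrite -subset0 -SU0 setIS.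
rewrite SU0 SU'0 !max_over0 !subr0 !inE eF SP0 eqxx /= andbT orbF subr0.
(* When all remaining minima of the edge lie in [P], the rate is constant on them and the edge is
   charged now. *)
have [/andP[/set0Pn[u]]|] := boolP (_ && _).
  rewrite inE => /andP[uI uU] /subsetP IP.
  rewrite /= addr0 mulr1n; congr (_ * _).
  rewrite (@min_over_eq _ _ _ _ u) ?in_setI ?uI //= ?rP ?IP ?in_setI ?uI //.
  by move=> v vIU /=; rewrite !rP ?IP // in_setI uI.
(* Otherwise the edge survives. Minima inside [P] have the largest rate, so dropping them does not
   change the minimum of [G \o r]. *)
rewrite negb_and negbK => nI; rewrite /= mul0r add0r mulr1n; congr (_ * _).
have [IU0|I0] := eqVneq (Imin e :&: U) set0.
  by rewrite setIDA IU0 set0D !min_over0.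
have I'0 : Imin e :&: U' != set0.
  by rewrite setIDA setD_eq0; move: nI; rewrite (negPf I0).
have [u uI' eu] := min_over_mem (G \o r') I'0.
have /andP[uI uU'] : (u \in Imin e) && (u \in U') by rewrite -in_setI.
have uU : u \in U by apply: subsetP uU'; apply: subsetDl.
rewrite eu [RHS](@min_over_eq _ _ _ _ u) ?in_setI ?uI //= ?rU' //.
move=> v; rewrite inE => /andP[vI vU] /=.
have [vP|vP] := boolP (v \in P); first by rewrite (rP v vP) -(rU' u uU'); apply/G_homo/r_le.
have vU' : v \in U' by rewrite inE vP.
by rewrite rU' // -[G (r' u)]eu ge_min_over // in_setI vI.
Qed.

Lemma sum_partition_class (F : V -> R) :
  \sum_v F v = \sum_(U in [set fclass f v | v in [set: V]]) \sum_(v in U) F v.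
Proof.
rewrite (eq_bigl (fun v => v \in [set: V])); last by move=> v; rewrite in_setT.
rewrite (partition_big_imset (fclass f)) /=.
apply: eq_bigr => U /imsetP[u _ ->]; apply: eq_bigl => v; rewrite !inE /=.
apply/eqP/eqP => [/setP/(_ v)|fvu]; first by rewrite !inE eqxx => /esym/eqP.
by apply/setP=> t; rewrite !inE fvu.
Qed.

Lemma separated_class u : separated (fclass f u) (class_edges E f (fclass f u)).
Proof.
move=> e _ /set0Pn[a]; rewrite !inE => /andP[/andP[_ /eqP mina] /eqP fau].
move=> /set0Pn[b]; rewrite !inE => /andP[/andP[_ /eqP maxb] /eqP fbu].
by rewrite /cost -mina -maxb fau fbu subrr mulr0.
Qed.

(** The edges outside [class_edges] have no extremal vertex in the class, so both extrema take the
    dummy value 0 and the sum may run over all of [E]. *)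
Lemma sum_rate_class (G : R -> R) u : {homo G : a b / a <= b} ->
  let r := rate E w f in
  \sum_(v in fclass f u) vweight E w v * r v * G (r v) =
  \sum_(e in E) cost e *
    (min_over (Imin e :&: fclass f u) (G \o r)
     - max_over (Smax e :&: fclass f u) (G \o r)).
Proof.
move=> G_homo r; pose U := fclass f u.
have rE v : v \in U -> r v = assign_rates #|U| U (class_edges E f U) v.
  rewrite inE => /eqP fvu; rewrite /r ffunE.
  by have -> : fclass f v = U by apply/setP=> t; rewrite !inE fvu.
rewrite -/U (eq_bigr _ (fun v vU => congr2 *%R (congr1 _ (rE v vU)) (congr1 G (rE v vU)))).
have FE : class_edges E f U \subset E by apply/subsetP=> e; rewrite inE => /andP[].
rewrite sum_assign_rates //; last exact: separated_class.
rewrite [RHS](bigID (mem (class_edges E f U))) /= [X in _ = _ + X]big1 ?addr0.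
  apply: eq_big => [e|e _].
    by apply/idP/andP => [eC|[]//]; rewrite (subsetP FE).
  congr (_ * (_ - _)); [apply: eq_min_over | apply: eq_max_over];
    by move=> v; rewrite in_setI => /andP[_ vU] /=; rewrite rE.
move=> e /andP[eE]; rewrite inE eE /= negbK setIUl setU_eq0.
by move=> /andP[/eqP-> /eqP->]; rewrite max_over0 min_over0 subrr mulr0.
Qed.

(* G = 1 gives the identities that are linear in the rate, G = id its norm. *)
Lemma sum_rate (phi G : R -> R) : {homo G : a b / a <= b} ->
  let r := rate E w f in
  \sum_v vweight E w v * phi (f v) * r v * G (r v) =
  \sum_(e in E) cost e *
    (phi (min_over e f) * min_over (Imin e) (G \o r)
     - phi (max_over e f) * max_over (Smax e) (G \o r)).
Proof.
move=> G_homo r; rewrite sum_partition_class.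
(* The minima of an edge lie in a single class and so do its maxima. Indicators of these two level
   sets make the sum over classes collapse after exchanging the sums. *)
pose level c := [set v | f v == c].
rewrite (eq_bigr (fun U => \sum_(e in E) cost e *
    ((phi (min_over e f) * min_over (Imin e) (G \o r)) *+ (U == level (min_over e f))
   - (phi (max_over e f) * max_over (Smax e) (G \o r)) *+ (U == level (max_over e f)))));
  last first.
  move=> _ /imsetP[u _ ->].
  have -> : \sum_(v in fclass f u) vweight E w v * phi (f v) * r v * G (r v) =
     phi (f u) * \sum_(v in fclass f u) vweight E w v * r v * G (r v).
    rewrite mulr_sumr; apply: eq_bigr => v; rewrite inE => /eqP->.
    by rewrite !mulrA [phi _ * _]mulrC.
  rewrite sum_rate_class // mulr_sumr; apply: eq_bigr => e eE.
  rewrite mulrCA mulrBr; congr (_ * (_ - _)).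
    have [eU|neU] := eqVneq (fclass f u) (level (min_over e f)).
      have fu : f u = min_over e f.
        by move/setP/(_ u): eU; rewrite !inE eqxx => /esym/eqP.
      by rewrite fu mulr1n eU (setIidPl _) //; apply/subsetP=> t; rewrite !inE => /andP[].
    rewrite mulr0n (_ : _ :&: _ = set0) ?min_over0 ?mulr0 //.
    apply: contraNeq neU => /set0Pn[t]; rewrite !inE => /andP[/andP[_ /eqP <-] /eqP ftu].
    by apply/eqP/setP=> x; rewrite !inE ftu.
  have [eU|neU] := eqVneq (fclass f u) (level (max_over e f)).
    have fu : f u = max_over e f.
      by move/setP/(_ u): eU; rewrite !inE eqxx => /esym/eqP.
    by rewrite fu mulr1n eU (setIidPl _) //; apply/subsetP=> t; rewrite !inE => /andP[].
  rewrite mulr0n (_ : _ :&: _ = set0) ?max_over0 ?mulr0 //.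
  apply: contraNeq neU => /set0Pn[t]; rewrite !inE => /andP[/andP[_ /eqP <-] /eqP ftu].
  by apply/eqP/setP=> x; rewrite !inE ftu.
rewrite exchange_big /=; apply: eq_bigr => e eE.
rewrite -mulr_sumr sumrB; congr (_ * (_ - _)).
  have [a aE ea] := min_over_mem f (E_neq0 eE).
  rewrite (bigD1 (level (min_over e f))) /=; last by rewrite ea; apply/imsetP; exists a.
  rewrite eqxx mulr1n big1 ?addr0 // => U /andP[_ /negPf->].
  by rewrite mulr0n.
have [a aE ea] := max_over_mem f (E_neq0 eE).
rewrite (bigD1 (level (max_over e f))) /=; last by rewrite ea; apply/imsetP; exists a.
rewrite eqxx mulr1n big1 ?addr0 // => U /andP[_ /negPf->].
by rewrite mulr0n.
Qed.

Lemma Imin_neq0 e : e \in E -> Imin e != set0.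
Proof.
move=> /E_neq0 /(min_over_mem f)[a ae ea].
by apply/set0Pn; exists a; rewrite inE ae ea eqxx.
Qed.

Lemma Smax_neq0 e : e \in E -> Smax e != set0.
Proof.
move=> /E_neq0 /(max_over_mem f)[a ae ea].
by apply/set0Pn; exists a; rewrite inE ae ea eqxx.
Qed.

(** The form Q, the numerator of the discrepancy ratio in the variable [W^{-1/2} x]. *)
Definition energy (g : V -> R) :=
  \sum_(e in E) w e * (max_over e g - min_over e g) ^+ 2.

(** Each edge gives its cost at its minima and takes it back at its maxima. Hence moving along the
    rate preserves orthogonality to the constants. *)
Lemma sum_rate0 : \sum_v vweight E w v * rate E w f v = 0.
Proof.
have /= := @sum_rate (fun=> 1) (fun=> 1) (fun _ _ _ => lexx _).
under eq_bigr do rewrite !mulr1.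
move=> ->; apply: big1 => e eE.
by rewrite max_over_cst min_over_cst Imin_neq0 // Smax_neq0 // subrr mulr0.
Qed.

Lemma sum_mul_rate : \sum_v vweight E w v * f v * rate E w f v = - energy f.
Proof.
have /= := @sum_rate id (fun=> 1) (fun _ _ _ => lexx _).
under eq_bigr do rewrite !mulr1.
move=> ->; rewrite -sumrN; apply: eq_bigr => e eE.
rewrite max_over_cst min_over_cst Imin_neq0 // Smax_neq0 // /cost.
by rewrite /= mulr1n !mulr1 -mulrA -mulrN expr2 -mulrN opprB.
Qed.

Lemma sum_rate_sqr : \sum_v vweight E w v * rate E w f v ^+ 2 =
  \sum_(e in E) cost e *
    (min_over (Imin e) (rate E w f) - max_over (Smax e) (rate E w f)).
Proof.
have /= := @sum_rate (fun=> 1) id (fun _ _ => id).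
under eq_bigr do rewrite mulr1 -mulrA -expr2.
by move=> ->; apply: eq_bigr => e _; rewrite !mul1r.
Qed.

End RatesTheory.

(** * Perturbation along the rate *)

Section Variation.
Context {R : realType} {V : finType}.
Implicit Types (f g : {ffun V -> R^o}) (A e : {set V}).

(** There are finitely many pairs, and each strict inequality tolerates a step of size gap over
    difference of slopes. The summand 1 in the denominator of [tau] avoids a division by zero. *)
Lemma lt_small_step f g : exists2 t0 : R, 0 < t0 & forall t u v,
  0 <= t -> t <= t0 -> f u < f v -> f u + t * g u <= f v + t * g v.
Proof.
pose tau (p : V * V) : R := if f p.1 < f p.2
  then (f p.2 - f p.1) / (`|g p.1 - g p.2| + 1) else 1.
have den (p : V * V) : 0 < `|g p.1 - g p.2| + 1 by rewrite ltr_wpDl.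
exists (\big[Num.min/1]_p tau p).
  apply: (big_ind (fun x => 0 < x)) => // [x y x0 y0|p _].
    by rewrite lt_min x0.
  by rewrite /tau; case: ifP => // lt; rewrite divr_gt0 // subr_gt0.
move=> t u v t0 tle fuv; have : t <= tau (u, v).
  by apply: le_trans tle _; apply: bigmin_le.
rewrite /tau /= fuv ler_pdivlMr ?(den (u, v)) // => le1.
have : t * (g u - g v) <= t * (`|g u - g v| + 1).
  by rewrite ler_wpM2l // ler_wpDr // ler_norm.
by move: le1; rewrite /= mulrBr; lra.
Qed.

(** A maximizer of [f + t g] outside [Smax f A] starts strictly below the maximum of [f], hence by
    [step] stays below the vertex of [Smax f A] where [g] is largest. *)
Lemma max_over_step f g A t :
  (forall u v, f u < f v -> f u + t * g u <= f v + t * g v) -> 0 <= t ->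
  max_over A (fun u => f u + t * g u) <= max_over A f + t * max_over (Smax f A) g.
Proof.
move=> step t0; have [->|A0] := eqVneq A set0.
  rewrite !max_over0 (_ : Smax f set0 = set0) ?max_over0 ?mulr0 ?addr0 //.
  by apply/setP=> u; rewrite !inE.
have [a aA ea] := max_over_mem (fun u => f u + t * g u) A0; rewrite ea.
have S0 : Smax f A != set0.
  have [b bA eb] := max_over_mem f A0.
  by apply/set0Pn; exists b; rewrite inE bA eb eqxx.
have [s sS es] := max_over_mem g S0.
have /andP[sA /eqP fs] : (s \in A) && (f s == max_over A f) by move: sS; rewrite inE.
have [fa|fa] := eqVneq (f a) (max_over A f).
  by rewrite fa lerD2l ler_wpM2l // le_max_over // inE aA fa eqxx.
rewrite es -fs; apply: step.
by rewrite fs lt_neqAle fa le_max_over.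
Qed.

Lemma min_over_step f g A t :
  (forall u v, f u < f v -> f u + t * g u <= f v + t * g v) -> 0 <= t ->
  min_over A f + t * min_over (Imin f A) g <= min_over A (fun u => f u + t * g u).
Proof.
move=> step t0; have [->|A0] := eqVneq A set0.
  rewrite !min_over0 (_ : Imin f set0 = set0) ?min_over0 ?mulr0 ?addr0 //.
  by apply/setP=> u; rewrite !inE.
have [a aA ea] := min_over_mem (fun u => f u + t * g u) A0; rewrite ea.
have S0 : Imin f A != set0.
  have [b bA eb] := min_over_mem f A0.
  by apply/set0Pn; exists b; rewrite inE bA eb eqxx.
have [s sS es] := min_over_mem g S0.
have /andP[sA /eqP fs] : (s \in A) && (f s == min_over A f) by move: sS; rewrite inE.
have [fa|fa] := eqVneq (f a) (min_over A f).
  by rewrite fa lerD2l ler_wpM2l // ge_min_over // inE aA fa eqxx.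
rewrite es -fs; apply: step.
by rewrite fs lt_neqAle eq_sym fa ge_min_over.
Qed.

Variables (E : {set {set V}}) (w : {set V} -> R).
Hypothesis vweight_gt0 : forall v, 0 < vweight E w v.
Hypothesis E_neq0 : forall e, e \in E -> e != set0.
Hypothesis w_ge0 : forall e, e \in E -> 0 <= w e.

(** On each edge the spread grows at most linearly in [t]; squaring the bound gives the first-order
    term and the quadratic remainder [K]. *)
Lemma energy_step f g : exists2 t0 : R, 0 < t0 & exists K : R, forall t,
  0 <= t -> t <= t0 ->
  energy E w (fun v => f v + t * g v) <= energy E w f
   + 2 * t * (\sum_(e in E) cost w f e *
       (max_over (Smax f e) g - min_over (Imin f e) g)) + t ^+ 2 * K.
Proof.
have [t0 t0_gt0 step] := lt_small_step f g; exists t0 => //.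
exists (\sum_(e in E) w e * (max_over (Smax f e) g - min_over (Imin f e) g) ^+ 2).
move=> t t_ge0 t_le; rewrite !mulr_sumr -!big_split /=; apply: ler_sum => e eE.
have stp u v := step t u v t_ge0 t_le.
have := max_over_step e stp t_ge0; have := min_over_step e stp t_ge0.
have := le_min_max_over e (fun u => f u + t * g u).
rewrite /cost; have := w_ge0 eE.
move: (max_over e f) (min_over e f) => a b.
move: (max_over e _) (min_over e _) => c d.
move: (max_over _ _) (min_over _ _) => M m w0 dc hm hM.
have le : (c - d) ^+ 2 <= (a - b + t * (M - m)) ^+ 2.
  have h : c - d <= a - b + t * (M - m) by lra.
  have h0 : 0 <= c - d by lra.
  by nra.
have := ler_wpM2l w0 le.
rewrite (_ : w e * (a - b + t * (M - m)) ^+ 2 =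
   w e * (a - b) ^+ 2 + 2 * t * (w e * (a - b) * (M - m)) + t ^+ 2 * (w e * (M - m) ^+ 2)) //.
ring.
Qed.

(* Compares f with f + t r for small t > 0. *)
Lemma rate_of_minimizer f (gamma : R) :
  (forall g : V -> R, \sum_v vweight E w v * g v = 0 ->
     gamma * (\sum_v vweight E w v * g v ^+ 2) <= energy E w g) ->
  \sum_v vweight E w v * f v = 0 ->
  energy E w f = gamma * (\sum_v vweight E w v * f v ^+ 2) ->
  forall v, rate E w f v = - gamma * f v.
Proof.
move=> min_gamma f0 ef; set r := rate E w f.
have [t0 t0_gt0 [K hK]] := energy_step f r.
have r0 : \sum_v vweight E w v * r v = 0 by apply: sum_rate0.
have fr : \sum_v vweight E w v * f v * r v = - energy E w f by apply: sum_mul_rate.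
have := sum_rate_sqr vweight_gt0 E_neq0 w_ge0 f; rewrite -/r => rr.
set S := \sum_v _ * f _ ^+ 2 in ef; set N := \sum_v _ * _ ^+ 2 in rr.
have rh : \sum_(e in E) cost w f e *
    (max_over (Smax f e) r - min_over (Imin f e) r) = - N.
  by rewrite rr -sumrN; apply: eq_bigr => e _; rewrite -mulrN opprB.
(* Minimality bounds the energy of [f + t r] from below and [energy_step] from above; the constant
   terms cancel and a factor [t] is divided out. *)
have key t : 0 < t -> t <= t0 -> 2 * (N - gamma ^+ 2 * S) <= t * (K - gamma * N).
  move=> t_gt0 t_le; have := hK t (ltW t_gt0) t_le; rewrite rh ef => up.
  have := min_gamma (fun v => f v + t * r v).
  have -> : \sum_v vweight E w v * (f v + t * r v) = 0.
    under eq_bigr do rewrite mulrDr mulrCA.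
    by rewrite big_split /= f0 -mulr_sumr r0 mulr0 addr0.
  move=> /(_ erefl).
  have -> : \sum_v vweight E w v * (f v + t * r v) ^+ 2 =
      S + 2 * t * - (gamma * S) + t ^+ 2 * N.
    rewrite -ef -fr /S /N !mulr_sumr -!big_split /=; apply: eq_bigr => v _.
    ring.
  move=> low; rewrite -(ler_pM2l t_gt0); move: low up; lra.
have NS : N <= gamma ^+ 2 * S.
  rewrite leNgt; apply/negP => lt.
  (* Makes the limit [t -> 0] explicit: for the [t] below, the right side of [key] is at most
     [N - gamma ^+ 2 * S], half of its left side, which is absurd when this is positive. *)
  pose d := `|K - gamma * N| + 1.
  have d0 : 0 < d by rewrite ltr_wpDl.
  pose t := Num.min t0 ((N - gamma ^+ 2 * S) / d).
  have t_gt0 : 0 < t by rewrite lt_min t0_gt0 divr_gt0 // subr_gt0.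
  have := key t t_gt0; rewrite ge_min lexx /= => /(_ isT).
  have td : t * d <= N - gamma ^+ 2 * S by rewrite -ler_pdivlMr // ge_min lexx orbT.
  have : t * (K - gamma * N) <= t * d.
    by rewrite ler_pM2l // ler_wpDr // ler_norm.
  by lra.
(* The sum of these nonnegative terms expands to [N - gamma ^+ 2 * S <= 0]. *)
have sq v : vweight E w v * (r v + gamma * f v) ^+ 2 = 0.
  have sq_ge0 u : true -> 0 <= vweight E w u * (r u + gamma * f u) ^+ 2.
    by rewrite mulr_ge0 ?sqr_ge0 // ltW.
  apply: (psumr_eq0P sq_ge0) => //; apply/le_anti; rewrite sumr_ge0 // andbT.
  have -> : \sum_u vweight E w u * (r u + gamma * f u) ^+ 2 =
      N + 2 * gamma * - (gamma * S) + gamma ^+ 2 * S.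
    rewrite -ef -fr /S /N !mulr_sumr -!big_split /=; apply: eq_bigr => u _.
    ring.
  by move: NS; lra.
move=> v; have /eqP := sq v; rewrite mulf_eq0 gt_eqF //= sqrf_eq0 addr_eq0 => /eqP->.
by rewrite mulNr.
Qed.

End Variation.

(** * Minimization on the unit sphere *)

Section ContinuousFun.
Context {R : realType} {T : topologicalType}.
Implicit Types f g : T -> R.

Lemma continuous_fun_sum (I : finType) (P : pred I) (F : I -> T -> R) :
  (forall i, P i -> continuous (F i)) ->
  continuous (fun z => \sum_(i | P i) F i z).
Proof. by move=> cF; apply: continuous_big => //; apply: add_continuous. Qed.

Lemma continuous_fun_bigmax (I : finType) (P : pred I) (c : R) (F : I -> T -> R) :
  (forall i, P i -> continuous (F i)) ->
  continuous (fun z => \big[Num.max/c]_(i | P i) F i z).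
Proof. by move=> cF; apply: continuous_big => //; apply: max_continuous. Qed.

Lemma continuous_fun_mul f g :
  continuous f -> continuous g -> continuous (fun z => f z * g z).
Proof. by move=> cf cg z; apply: continuousM; [apply: cf | apply: cg]. Qed.

Lemma continuous_fun_sqr f : continuous f -> continuous (fun z => f z ^+ 2).
Proof. by move=> cf; apply: continuous_fun_mul. Qed.

Lemma continuous_fun_sub f g :
  continuous f -> continuous g -> continuous (fun z => f z - g z).
Proof. by move=> cf cg z; apply: continuousB; [apply: cf | apply: cg]. Qed.

End ContinuousFun.

Section SphereMin.
Context {R : realType} {V : finType}.
Local Notation coord z := ([ffun v => z ord0 (enum_rank v)] : {ffun V -> R^o}).

Lemma continuous_coord (v : V) : continuous (fun z : 'rV[R]_#|V| => z ord0 (enum_rank v)).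
Proof. by move=> z; apply: coord_continuous. Qed.

(** The extreme value theorem is applied to row vectors, identified with functions on [V] through
    [enum_rank]. The constraint set is closed and lies in the cube [[-1, 1]^n], hence is compact. *)
Lemma sphere_min (b : V -> R) (N : {ffun V -> R^o} -> R) :
  continuous (fun z : 'rV[R]_#|V| => N (coord z)) ->
  (exists x : {ffun V -> R^o}, \sum_v x v ^+ 2 = 1 /\ \sum_v x v * b v = 0) ->
  exists x : {ffun V -> R^o}, [/\ \sum_v x v ^+ 2 = 1, \sum_v x v * b v = 0 &
    forall y : {ffun V -> R^o}, \sum_v y v ^+ 2 = 1 -> \sum_v y v * b v = 0 -> N x <= N y].
Proof.
move=> cN [x0 [x01 x0b]].
pose row (x : {ffun V -> R^o}) : 'rV[R]_#|V| := \row_i x (enum_val i).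
have coordK x : coord (row x) = x by apply/ffunP=> v; rewrite ffunE mxE enum_rankK.
pose f1 (z : 'rV[R]_#|V|) := \sum_v z ord0 (enum_rank v) ^+ 2.
pose f2 (z : 'rV[R]_#|V|) := \sum_v z ord0 (enum_rank v) * b v.
pose A : set 'rV[R]_#|V| := ((f1 @^-1` [set x | x = 1]) `&` (f2 @^-1` [set x | x = 0]))%classic.
have inA (x : {ffun V -> R^o}) : \sum_v x v ^+ 2 = 1 -> \sum_v x v * b v = 0 -> A (row x).
  move=> x1 xb; split; rewrite /f1 /f2 /preimage /=.
    by rewrite -[RHS]x1; apply: eq_bigr => v _; rewrite mxE enum_rankK.
  by rewrite -[RHS]xb; apply: eq_bigr => v _; rewrite mxE enum_rankK.
have cf1 : continuous f1.
  by apply: continuous_fun_sum => v _; apply: continuous_fun_sqr; apply: continuous_coord.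
have cf2 : continuous f2.
  apply: continuous_fun_sum => v _; apply: continuous_fun_mul.
    exact: continuous_coord.
  exact: cst_continuous.
have closedA : topology_structure.closed A.
  by apply: closedI; apply: (closed_comp (fun x _ => _ x) (@closed_eq _ _)).
have compactA : compact A.
  apply: (subclosed_compact closedA (@rV_compact R^o #|V| (fun=> `[-1, 1]%classic) _)).
    by move=> _; apply: segment_compact.
  move=> z [z1 _] i /=.
  have : z ord0 i ^+ 2 <= 1.
    rewrite -z1 /f1 (bigD1 (enum_val i)) //= enum_valK lerDl sumr_ge0 // => v _.
    exact: sqr_ge0.
  by rewrite in_itv /= => zi; apply/andP; split; nra.
have [z zA zmin] := EVT_min_rV (ex_intro _ _ (inA _ x01 x0b)) compactA
  (continuous_subspaceT cN).
exists (coord z); have [z1 zb] := set_mem zA; split.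
- by rewrite -[RHS]z1; apply: eq_bigr => v _; rewrite ffunE.
- by rewrite -[RHS]zb; apply: eq_bigr => v _; rewrite ffunE.
move=> y y1 yb; rewrite -[y in leRHS]coordK; apply: zmin.
by apply: mem_set; apply: inA.
Qed.
End SphereMin.

(** * Rayleigh quotient and minimizers *)

Section Spectral.
Context {R : realType} {V : finType}.
Variables (E : {set {set V}}) (w : {set V} -> R).
Hypothesis vweight_gt0 : forall v, 0 < vweight E w v.
Hypothesis E_neq0 : forall e, e \in E -> e != set0.
Hypothesis w_ge0 : forall e, e \in E -> 0 <= w e.
Implicit Types (x y : {ffun V -> R^o}) (g : V -> R).

Local Notation s v := (Num.sqrt (vweight E w v)).
Local Notation Winvsqrt := (Winvsqrt E w).
Local Notation energy := (energy E w).

Lemma sqrt_vweight_gt0 v : 0 < s v.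
Proof. by rewrite sqrtr_gt0. Qed.

Lemma sqr_sqrt_vweight v : s v ^+ 2 = vweight E w v.
Proof. by rewrite sqr_sqrtr // ltW. Qed.

Lemma Winvsqrt_mulK x v : s v * Winvsqrt x v = x v.
Proof. by rewrite ffunE mulVKf // gt_eqF // sqrt_vweight_gt0. Qed.

Lemma energy_ge0 g : 0 <= energy g.
Proof. by apply: sumr_ge0 => e eE; rewrite mulr_ge0 ?w_ge0 ?sqr_ge0. Qed.

Lemma energyE g : energy g =
  \sum_(e in E) w e * max_over (setX e e) (fun p => (g p.1 - g p.2) ^+ 2).
Proof. by apply: eq_bigr => e _; rewrite max_over_sqr_diff. Qed.

Lemma eq_energy g h : g =1 h -> energy g = energy h.
Proof.
by move=> gh; apply: eq_bigr => e _;
   rewrite (@eq_max_over _ _ _ g h) ?(@eq_min_over _ _ _ g h).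
Qed.

(** Going through squared differences makes the scalar [k ^+ 2] nonnegative, whatever the sign of
    [k]. *)
Lemma energyZ (k : R) g : energy (fun v => k * g v) = k ^+ 2 * energy g.
Proof.
rewrite !energyE mulr_sumr; apply: eq_bigr => e _.
rewrite mulrCA -[in RHS]max_overZ ?sqr_ge0 //; congr (_ * _).
by apply: eq_max_over => p _; rewrite -mulrBr exprMn.
Qed.

Lemma discrepancy_ratioE x :
  discrepancy_ratio E w x = energy (Winvsqrt x) / \sum_v x v ^+ 2.
Proof.
rewrite /discrepancy_ratio energyE; congr (_ / _).
apply: eq_bigr => e _; congr (_ * _); apply: eq_max_over => p _.
by rewrite !ffunE ![_^-1 * _]mulrC.
Qed.

Lemma sum_vweight_Winvsqrt_sqr x :
  \sum_v vweight E w v * Winvsqrt x v ^+ 2 = \sum_v x v ^+ 2.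
Proof.
apply: eq_bigr => v _.
by rewrite -[in RHS](Winvsqrt_mulK x v) exprMn sqr_sqrt_vweight.
Qed.

Lemma sum_vweight_Winvsqrt x :
  \sum_v vweight E w v * Winvsqrt x v = \sum_v x v * s v.
Proof.
apply: eq_bigr => v _.
by rewrite -[in RHS](Winvsqrt_mulK x v) -[X in X * _ = _]sqr_sqrt_vweight; ring.
Qed.

Lemma inner_Wsqrt1 x : inner x (Wsqrt E w [ffun=> 1]) = \sum_v x v * s v.
Proof. by apply: eq_bigr => v _; rewrite !ffunE mulr1. Qed.

Lemma sum_sqr_gt0 x : x != 0 -> 0 < \sum_v x v ^+ 2.
Proof.
move=> x0; rewrite lt_neqAle sumr_ge0 ?andbT; last by move=> v _; apply: sqr_ge0.
rewrite eq_sym; apply: contraNneq x0 => sum0.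
apply/eqP/ffunP=> v; rewrite ffunE; apply/eqP; rewrite -sqrf_eq0; apply/eqP.
by apply: (psumr_eq0P (fun u _ => sqr_ge0 (x u)) sum0).
Qed.

(** With [f = W^{-1/2} x], the two factors [W^{1/2}] in the numerator combine into [W], which leaves
    [- <f, r>_w]. *)
Lemma Rayleigh_discrepancy_ratio x :
  Rayleigh E w x = discrepancy_ratio E w x.
Proof.
rewrite discrepancy_ratioE /Rayleigh; congr (_ / _).
rewrite -[RHS]opprK -sum_mul_rate // -sumrN.
apply: eq_bigr => v _; rewrite -[in LHS](Winvsqrt_mulK x v).
rewrite [Laplacian _ _ _ _]ffunE [Lw _ _ _ _]ffunE
  -[X in - (X * _ * _)]sqr_sqrt_vweight; ring.
Qed.

Lemma continuous_energy (T : topologicalType) (F : T -> {ffun V -> R^o}) :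
  (forall v, continuous (fun z => F z v : R)) -> continuous (fun z => energy (F z)).
Proof.
move=> cF; have -> : (fun z => energy (F z)) = (fun z => \sum_(e in E) w e *
    \big[Num.max/0]_(p in setX e e) (F z p.1 - F z p.2) ^+ 2).
  apply: boolp.funext => z; rewrite energyE; apply: eq_bigr => e _.
  by rewrite max_over_bigmax // => p _; apply: sqr_ge0.
apply: continuous_fun_sum => e _; apply: continuous_fun_mul.
  exact: cst_continuous.
apply: continuous_fun_bigmax => p _; apply: continuous_fun_sqr.
exact: continuous_fun_sub.
Qed.

Lemma unit_scale x : x != 0 -> exists2 k : R, 0 < k &
  k ^+ 2 * (\sum_v x v ^+ 2) = 1 /\ \sum_v (k *: x) v ^+ 2 = 1.
Proof.
move=> x0; have n0 := sum_sqr_gt0 x0.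
exists (Num.sqrt (\sum_v x v ^+ 2))^-1; first by rewrite invr_gt0 sqrtr_gt0.
have e : (Num.sqrt (\sum_v x v ^+ 2))^-1 ^+ 2 * (\sum_v x v ^+ 2) = 1.
  by rewrite exprVn sqr_sqrtr ?ltW // mulVf // gt_eqF.
split=> //; rewrite -[RHS]e mulr_sumr; apply: eq_bigr => v _.
by rewrite ffunE exprMn.
Qed.

Lemma ex_admissible : (1 < #|V|)%N -> exists x, admissible E w x.
Proof.
move=> /card_gt1P[u [v [_ _ uv]]].
(* Supported on two vertices with swapped square roots, so that the inner product is
   [s v * s u - s u * s v]. *)
exists [ffun t => if t == u then s v else if t == v then - s u else 0]; split.
  apply/eqP=> /ffunP/(_ u); rewrite !ffunE eqxx => /eqP.
  by rewrite gt_eqF // sqrt_vweight_gt0.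
rewrite inner_Wsqrt1 (bigD1 u) // (bigD1 v) /=; last by rewrite eq_sym.
rewrite big1 => [|t].
  by rewrite !ffunE eqxx eq_sym (negPf uv) eqxx; ring.
by move=> /andP[/negPf tu /negPf tv]; rewrite ffunE tu tv mul0r.
Qed.

(** Minimality is stated without a quotient, so that it also covers [y = 0], as the variational
    argument requires. *)
Lemma ex_minimizer : (1 < #|V|)%N -> exists gamma : R, exists2 x,
  admissible E w x /\ discrepancy_ratio E w x = gamma &
  forall y, \sum_v y v * s v = 0 ->
    gamma * (\sum_v y v ^+ 2) <= energy (Winvsqrt y).
Proof.
move=> V2; have [x0 [x0_neq0]] := ex_admissible V2; rewrite inner_Wsqrt1 => x0s.
have scale_s (k : R) y : \sum_v y v * s v = 0 -> \sum_v (k *: y) v * s v = 0.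
  move=> y0; rewrite -[RHS](mulr0 k) -[in RHS]y0 mulr_sumr.
  by apply: eq_bigr => v _; rewrite ffunE -mulrA.
have [|| x [x1 xs xmin]] := @sphere_min R V (fun v => s v) (fun x => energy (Winvsqrt x)).
- apply: continuous_energy => v.
  have -> : (fun z : 'rV[R]_#|V| => Winvsqrt [ffun u => z ord0 (enum_rank u)] v) =
     (fun z => (s v)^-1 * z ord0 (enum_rank v)).
    by apply: boolp.funext => z; rewrite !ffunE.
  apply: continuous_fun_mul; first exact: cst_continuous.
  exact: continuous_coord.
- by have [k _ [_ k1]] := unit_scale x0_neq0; exists (k *: x0); split=> //; apply: scale_s.
exists (energy (Winvsqrt x)), x.
  split; last by rewrite discrepancy_ratioE x1 divr1.
  split; last by rewrite inner_Wsqrt1.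
  apply/eqP=> x_eq0; move: x1; rewrite x_eq0 big1 => [/esym/eqP|v _].
    by rewrite oner_eq0.
  by rewrite ffunE expr0n.
move=> y ys; have [->|y0] := eqVneq y 0.
  rewrite big1 ?mulr0 ?energy_ge0 // => v _.
  by rewrite ffunE expr0n.
(* Both sides are homogeneous of degree 2, so the bound on the unit sphere extends to every nonzero
   [y]. *)
have [k k0 [k1 k2]] := unit_scale y0.
have := xmin (k *: y) k2 (scale_s k y ys).
rewrite (@eq_energy (Winvsqrt (k *: y)) (fun v => k * Winvsqrt y v)); last first.
  by move=> v; rewrite !ffunE mulrCA.
rewrite energyZ => le; have k20 : 0 < k ^+ 2 by rewrite exprn_gt0.
by rewrite -(ler_pM2l k20) mulrCA k1 mulr1.
Qed.

Lemma Laplacian_of_minimizer (gamma : R) x :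
  (forall y, \sum_v y v * s v = 0 ->
    gamma * (\sum_v y v ^+ 2) <= energy (Winvsqrt y)) ->
  admissible E w x -> discrepancy_ratio E w x = gamma ->
  Laplacian E w x = gamma *: x.
Proof.
move=> gmin [x0]; rewrite inner_Wsqrt1 => xs Dx.
have n0 := sum_sqr_gt0 x0.
have rE : forall v, rate E w (Winvsqrt x) v = - gamma * Winvsqrt x v.
  apply: rate_of_minimizer => //.
  (* Substituting [y = W^{1/2} g] turns minimality over [x] into the weighted inequality for [g]. *)
  - move=> g g0; pose y : {ffun V -> R^o} := [ffun v => s v * g v].
    have yg : Winvsqrt y =1 g.
      by move=> v; rewrite !ffunE mulKf // gt_eqF // sqrt_vweight_gt0.
    rewrite -(eq_energy yg) -[X in gamma * X](_ : \sum_v y v ^+ 2 = _).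
      apply: gmin; rewrite -[RHS]g0; apply: eq_bigr => v _.
      by rewrite ffunE -[X in _ = X * _]sqr_sqrt_vweight; ring.
    by apply: eq_bigr => v _; rewrite ffunE exprMn sqr_sqrt_vweight.
  - by rewrite sum_vweight_Winvsqrt.
  rewrite sum_vweight_Winvsqrt_sqr -Dx discrepancy_ratioE divfK //.
  by rewrite gt_eqF.
apply/ffunP=> v; rewrite [LHS]ffunE [Lw _ _ _ _]ffunE rE [RHS]ffunE.
by rewrite -[in RHS](Winvsqrt_mulK x v) mulNr opprK mulrCA.
Qed.

End Spectral.

Theorem mainTheorem1 (R : realType) (V : finType)
    (E : {set {set V}}) (w : {set V} -> R)
    (hn : (2 <= #|V|)%N)
    (hE : forall e : {set V}, e \in E -> e != set0)
    (hw : forall e : {set V}, e \in E -> 0 <= w e)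
    (hv : forall v : V, 0 < vweight E w v) :
  (forall x : {ffun V -> R^o}, x != 0 ->
     Rayleigh E w x = discrepancy_ratio E w x) /\
  (exists gamma2 : R,
     [/\ is_min [set discrepancy_ratio E w x | x in
                   [set x : {ffun V -> R^o} | admissible E w x]]%classic gamma2,
         is_eigenvalue (Laplacian E w) gamma2 &
         forall x2 : {ffun V -> R^o},
           admissible E w x2 -> discrepancy_ratio E w x2 = gamma2 ->
           is_eigenvector (Laplacian E w) gamma2 x2]).
Proof.
split=> [x _|]; first exact: Rayleigh_discrepancy_ratio.
have [gamma [x [xadm Dx] gmin]] := ex_minimizer hv hw hn.
have eigen y : admissible E w y -> discrepancy_ratio E w y = gamma ->
    is_eigenvector (Laplacian E w) gamma y.
  by move=> yadm Dy; split; [case: yadm | apply: Laplacian_of_minimizer].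
exists gamma; split=> //; last by exists x; apply: eigen.
split; first by exists x.
move=> _ [y [y0 ys] <-]; rewrite discrepancy_ratioE.
by rewrite ler_pdivlMr ?sum_sqr_gt0 // gmin // -inner_Wsqrt1.
Qed.
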